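(* Let $\Omega$ be a nonempty finite set and let $s:\mathcal C\to[0,\infty]^\Omega$ be a strictly proper scoring rule. Let $S_s=\{s(p):p\in\mathcal P\}$ and $F_s=S_s\cap[0,\infty)^\Omega$, and suppose that $S_s$ is the closure of $F_s$ in $[0,\infty]^\Omega$. Then for every $c\in\mathcal C\setminus\mathcal P$ there is a probability $p\in\mathcal P$ such that $s(p)(\omega)<s(c)(\omega)$ for all $\omega\in\Omega$.
   Context: $\Omega$ is a nonempty finite set. $\mathcal C$ is the set of all functions from the power set of $\Omega$ to $\mathbb R$ (credence functions). $\mathcal P\subseteq\mathcal C$ is the set of those functions that satisfy the axioms of (finitely additive) probability. A scoring rule is a function $s:\mathcal C\to[0,\infty]^\Omega$; so for $c\in\mathcal C$, $s(c)$ is a function from $\Omega$ to $[0,\infty]$. The space $[0,\infty]^\Omega$ carries the product topology (with the usual topology on $[0,\infty]$). For $p\in\mathcal P$ and $f:\Omega\to[0,\infty]$, define $$E_p f=\sum_{\omega\in\Omega,\ p(\{\omega\})\neq 0}p(\{\omega\})f(\omega)\in[0,\infty].$$ A scoring rule $s$ is proper if $E_p s(p)\le E_p s(c)$ for all $p\in\mathcal P$ and $c\in\mathcal C$. It is strictly proper if $E_p s(p)<E_p s(c)$ for all $p\in\mathcal P$ and all $c\in\mathcal C$ with $c\neq p$. *)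

(* Defs.v *)
From HB Require Import structures.
From mathcomp Require Import all_boot all_order all_algebra.
From mathcomp Require Import all_classical all_reals all_analysis.

Set Implicit Arguments.
Unset Strict Implicit.
Unset Printing Implicit Defensive.

Import Order.TTheory GRing.Theory Num.Theory.
Import numFieldNormedType.Exports.

Local Open Scope classical_set_scope.
Local Open Scope ring_scope.

Section ScoringRules.
Context {R : realType} {Omega : finType}.

Definition credence : Type := {ffun {set Omega} -> R}.

Definition probabilities : set credence :=
  [set p : credence | [/\ forall A : {set Omega}, 0 <= p A,
               p [set: Omega]%SET = 1 &
               forall A B : {set Omega}, [disjoint A & B]%B ->
                 p (A :|: B)%SET = p A + p B]].

(* {ptws Omega -> \bar R} is Omega -> \bar R with the product topology. *)
Definition score_space : Type := {ptws Omega -> \bar R}.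

Definition nonneg_scores : set score_space :=
  [set f | forall w, (0 <= f w)%E].

Definition finite_scores : set score_space :=
  [set f | forall w, (0 <= f w < +oo)%E].

Definition scoring_rule (s : credence -> score_space) : Prop :=
  forall c, nonneg_scores (s c).

(* The restriction to p({w}) <> 0 is redundant in \bar R, where 0 * +oo = 0. *)
Definition expect (p : credence) (f : score_space) : \bar R :=
  (\sum_(w : Omega | p [set w]%SET != 0%R) (p [set w]%SET)%:E * f w)%E.

Definition strictly_proper (s : credence -> score_space) : Prop :=
  forall p c, probabilities p -> c <> p ->
    (expect p (s p) < expect p (s c))%E.

Definition prob_scores (s : credence -> score_space) : set score_space :=
  s @` probabilities.

Definition finite_prob_scores (s : credence -> score_space) : set score_space :=
  prob_scores s `&` finite_scores.

(* The closure in [0, +oo]^Omega with the topology induced from \bar R^Omega;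
   [0, +oo]^Omega being closed there, the intersection changes nothing when
   F lies in it. *)
Definition nonneg_closure (F : set score_space) : set score_space :=
  closure (F : set {ptws Omega -> \bar R}) `&` nonneg_scores.

End ScoringRules.

Arguments credence R Omega : clear implicits.
Arguments score_space R Omega : clear implicits.

(* Main.v *)
Require Import Defs.
From mathcomp Require Import all_boot all_order all_algebra.
From mathcomp Require Import all_classical all_reals all_analysis.
From mathcomp Require Import lra.

Set Implicit Arguments.
Unset Strict Implicit.
Unset Printing Implicit Defensive.

Import Order.TTheory GRing.Theory Num.Theory.
Import numFieldNormedType.Exports.

Local Open Scope classical_set_scope.
Local Open Scope ring_scope.

(** Write E_q f for the mean of a score f under a probability q, let c be a
    credence function that is not a probability, and put f := s(c) and
    D := {w | f(w) < +oo}.  Since c is no probability, strict propriety gives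
    E_q s(q) < E_q f for every probability q.

    On the compact simplex of probabilities carried by D, consider the gap
    q |-> E_q f - E_q s(q).  The hypothesis on the closure says that s(q) is a
    limit of finite scores of probabilities, so E_q s(q) is an infimum of
    functions that are linear in q; hence it is upper semicontinuous
    ([entropy_upper_semicontinuous]), the gap is lower semicontinuous, and it
    has a minimiser q with a minimum m > 0 ([gap_attains_min]).

    The minimiser dominates on D: s(q)(w) <= f(w) - m for each w in D
    ([score_of_minimiser]).  To see this, move q towards the point mass at w by
    q_t := (1 - t) q + t delta_w.  Minimality at q_t says
      (1 - t) E_q (f - s(q_t)) + t (f - s(q_t))(w) >= m,
    while propriety at q says E_q (f - s(q_t)) <= m; together,
    s(q_t)(w) <= f(w) - m, and also E_q s(q_t) <= E_q s(q) + O(t)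
    ([score_of_mix]).  The scores of probabilities form a closed subset of the
    compact space [0, +oo]^Omega, so as t tends to 0 the s(q_t) accumulate at
    some s(p) with s(p)(w) <= f(w) - m and E_q s(p) <= E_q s(q); strict
    propriety forces p = q.

    Off D, where f is +oo, it remains to have a finite score.  As s(q) is a
    limit of finite scores of probabilities and the strict inequalities on D
    are open conditions, one of these finite scores will do. *)

(** * Topological preliminaries *)

(** [contract] embeds the extended line isometrically onto [-1, 1]. *)
Lemma ereal_compact (R : realType) : compact [set: \bar R].
Proof.
move=> F PF _.
have [|r [r11 Fr]] := @segment_compact R (-1) 1 (@contract R x @[x --> F]) _.
  suff cT : @contract R @^-1` `[-1, 1] = [set: \bar R].
    by rewrite /nbhs/= cT; exact: filterT.
  rewrite predeqE => x; split=> // _.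
  by rewrite /= in_itv/= -ler_norml contract_le1.
exists (expand r); split=> // A B FA /nbhs_ballP[e /= e0 eB].
have cF : (@contract R x @[x --> F]) (@contract R @` A).
  by apply: (@filterS _ F _ A) => // x Ax; exists x.
have [_ [[x Ax <-] rx]] := Fr _ (ball r e) cF (nbhsx_ballx _ _ e0).
exists x; split=> //; apply: eB; rewrite /ball/= /ereal_ball expandK//.
by rewrite inE ler_norml; move: r11; rewrite /= in_itv.
Qed.

(** The nonempty sublevel sets form a filter base, being nested; lower
    semicontinuity puts each of its cluster points in all of them. *)
Lemma lower_semicontinuous_attains_min (T : topologicalType) d (U : orderType d)
    (K : set T) (g : T -> U) :
  compact K -> K !=set0 ->
  (forall x a, K x -> (a < g x)%O -> \forall y \near x, K y -> (a < g y)%O) ->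
  exists2 x, K x & forall y, K y -> (g x <= g y)%O.
Proof.
move=> cK [x0 Kx0] lsc.
pose F := filter_from K (fun y => [set x | K x /\ (g x <= g y)%O]).
have PF : ProperFilter F.
  apply: filter_from_proper; last by move=> x Kx; exists x.
  apply: filter_from_filter; first by exists x0.
  move=> x y Kx Ky; have [xy|/ltW yx] := leP (g x) (g y).
    by exists x => // z [Kz zx]; do 2!split=> //; exact: le_trans xy.
  by exists y => // z [Kz zy]; do 2!split=> //; exact: le_trans yx.
have [|x [Kx Fx]] := cK F PF; first by exists x0 => // z [].
exists x => // y Ky; rewrite leNgt; apply/negP => /(lsc _ _ Kx) nx.
have [|z [[Kz zy] /(_ Kz)]] := Fx [set z | K z /\ (g z <= g y)%O] _ _ nx.
  by exists y.
by rewrite ltNge zy.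
Qed.

(** * Probabilities as weights on points *)

Section Weights.
Context {R : realType} {Omega : finType}.

(** The simplex of probabilities carried by D. Working with point weights
    rather than credence functions makes it a subset of a product of lines. *)
Definition weights (D : {set Omega}) : set {ptws Omega -> R} :=
  [set q : {ptws Omega -> R} | [/\ forall w, 0 <= q w,
    forall w, w \notin D -> q w = 0 & \sum_w q w = 1]].

Definition prob_of (q : Omega -> R) : credence R Omega :=
  [ffun A : {set Omega} => \sum_(w in A) q w].

Definition mean (q : Omega -> R) (f : Omega -> \bar R) : \bar R :=
  (\sum_w (q w)%:E * f w)%E.

Lemma weights_linear_continuous (b : Omega -> R) :
  continuous (fun q : {ptws Omega -> R} => \sum_w q w * b w).
Proof.
apply: continuous_big => [|w _ q]; first exact: add_continuous.
have cw : (fun q' : {ptws Omega -> R} => q' w) @ q --> q w.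
  exact: (@proj_continuous Omega (fun=> R) w q).
exact: (@cvgM R {ptws Omega -> R} (nbhs q) _ _ (fun=> b w) _ _ cw (cvg_cst _)).
Qed.

Lemma near_linear_lt (b : Omega -> R) (q : {ptws Omega -> R}) z :
  \sum_w q w * b w < z -> \forall y \near q, \sum_w y w * b w < z.
Proof.
exact: (@cvgr_lt R _ (nbhs q) (nbhs_filter q) _ _
  (@weights_linear_continuous b q)).
Qed.

Lemma near_linear_gt (b : Omega -> R) (q : {ptws Omega -> R}) z :
  z < \sum_w q w * b w -> \forall y \near q, z < \sum_w y w * b w.
Proof.
exact: (@cvgr_gt R _ (nbhs q) (nbhs_filter q) _ _
  (@weights_linear_continuous b q)).
Qed.

Lemma weights_compact (D : {set Omega}) : compact (weights D).
Proof.
pose I (w : Omega) : set R := if w \in D then `[0, 1]%classic else [set 0].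
have -> : weights D = [set q : {ptws Omega -> R} | forall w, I w (q w)] `&`
    (fun q : {ptws Omega -> R} => \sum_w q w * 1) @^-1` [set 1].
  rewrite predeqE => q; split=> [[q0 qD q1]|[qI]].
    split=> /=; last by under eq_bigr do rewrite mulr1.
    move=> w; rewrite /I; case: ifPn => [wD|/qD//].
    rewrite /= in_itv/= q0/= -q1 (bigD1 w)//= lerDl.
    exact: sumr_ge0.
  rewrite /=; under eq_bigr do rewrite mulr1.
  move=> q1; split=> // w => [|wD]; have := qI w; rewrite /I.
    by case: ifPn => [_|_ ->//]; rewrite /= in_itv/= => /andP[].
  by rewrite (negbTE wD).
apply: compact_closedI.
  apply: (@tychonoff _ (fun=> R)) => w; rewrite /I; case: ifP => _.
    exact: segment_compact.
  exact: compact_set1.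
apply: preimage_closed; last exact: closed_eq.
by move=> q _; exact: weights_linear_continuous.
Qed.

Lemma prob_of_set1 (q : Omega -> R) w : prob_of q [set w]%SET = q w.
Proof. by rewrite ffunE big_set1. Qed.

Lemma prob_of_probability D q : weights D q -> probabilities (prob_of q).
Proof.
move=> [q0 _ q1]; split=> [A||A B AB]; rewrite !ffunE.
- exact: sumr_ge0.
- by rewrite -q1; apply: eq_bigl => w; rewrite finset.in_setT.
- by rewrite -bigU//; apply: eq_bigl => w; rewrite !inE.
Qed.

Lemma expect_prob_of q f : expect (prob_of q) f = mean q f.
Proof.
rewrite /expect /mean big_mkcond/=; apply: eq_bigr => w _.
by rewrite prob_of_set1; case: eqP => //= ->; rewrite mul0e.
Qed.

(** The absolute values keep +oo and -oo from meeting in a sum, which makes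
    the mean continuous on the whole space and not only on nonnegative
    scores. *)
Lemma mean_abse_continuous q : (forall w, 0 <= q w) ->
  continuous (fun f : score_space R Omega => mean q (fun w => `|f w|%E)).
Proof.
move=> q0 f.
have cf w : (fun g : score_space R Omega => (q w)%:E * `|g w|)%E @ nbhs f
    --> ((q w)%:E * `|f w|)%E.
  have cw := @proj_continuous Omega (fun=> \bar R) w f.
  have ca := @cvg_abse _ (nbhs f) (nbhs_filter f) R
    (fun g : score_space R Omega => g w) _ cw.
  exact: (@cvgeZl _ (nbhs f) R (fun g : score_space R Omega => `|g w|%E)
    `|f w|%E (q w)%:E isT ca).
have f0 w : xpredT w -> \forall g \near f, (0 <= (q w)%:E * `|g w|)%E.
  move=> _; apply: (@filterE _ _ (nbhs_filter f)) => g.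
  by rewrite mule_ge0// lee_fin.
exact: (@cvg_nnesum _ (nbhs f) (nbhs_pfilter f) R Omega (index_enum Omega)
  (fun w (g : score_space R Omega) => (q w)%:E * `|g w|)%E
  (fun w => (q w)%:E * `|f w|)%E xpredT f0 (fun w _ => cf w)).
Qed.

Lemma mean_abse q f : nonneg_scores f -> mean q (fun w => `|f w|%E) = mean q f.
Proof. by move=> f0; apply: eq_bigr => w _; rewrite gee0_abs. Qed.

Lemma mean_EFin q f : (forall w, q w != 0 -> f w \is a fin_num) ->
  mean q f = (\sum_w q w * fine (f w))%:E.
Proof.
move=> ffin; rewrite -sumEFin; apply: eq_bigr => w _.
have [->|/ffin fw] := eqVneq (q w) 0; first by rewrite mul0e mul0r.
by rewrite EFinM fineK.
Qed.

Lemma mean_fin_num q f w : (forall v, 0 <= q v) -> nonneg_scores f ->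
  (mean q f < +oo)%E -> q w != 0 -> f w \is a fin_num.
Proof.
move=> q0 f0 + qw; rewrite ge0_fin_numE//; apply: contraTT.
rewrite -!leNgt !leye_eq => /eqP fw; apply/eqP; rewrite /mean (bigD1 w)//= fw.
rewrite gt0_muley ?lte_fin ?lt_neqAle 1?eq_sym ?qw ?q0// addye//.
rewrite gt_eqF// (@lt_le_trans _ _ 0%E)//.
by apply: sume_ge0 => v _; rewrite mule_ge0// lee_fin.
Qed.

Lemma sum_indicator (w : Omega) : \sum_v (v == w)%:R = 1 :> R.
Proof. by rewrite (bigD1 w)//= eqxx big1 ?addr0// => v /negbTE->. Qed.

(** The segment from q to the point mass at w. *)
Definition mix (t : R) (q : Omega -> R) (w : Omega) : Omega -> R :=
  fun v => (1 - t) * q v + t * (v == w)%:R.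

Lemma mix_weights (D : {set Omega}) t q w : 0 <= t <= 1 -> w \in D ->
  weights D q -> weights D (mix t q w).
Proof.
move=> /andP[t0 t1] wD [q0 qD q1]; split=> [v|v vD|].
- by rewrite addr_ge0 ?mulr_ge0 ?subr_ge0.
- rewrite /mix qD// mulr0 add0r; case: eqP vD => [->|]; first by rewrite wD.
  by rewrite mulr0.
- rewrite big_split/= -!mulr_sumr q1 sum_indicator; lra.
Qed.

Lemma sum_mix t q w (b : Omega -> R) :
  \sum_v mix t q w v * b v = (1 - t) * (\sum_v q v * b v) + t * b w.
Proof.
under eq_bigr do rewrite mulrDl -!mulrA.
rewrite big_split/= -!mulr_sumr; congr (_ + _ * _).
rewrite (bigD1 w)//= eqxx mul1r big1 ?addr0// => v.
by move/negbTE->; rewrite mul0r.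
Qed.

Lemma nonneg_scores_compact : compact (@nonneg_scores R Omega).
Proof.
have -> : @nonneg_scores R Omega =
    [set f : {ptws Omega -> \bar R} | forall w, [set x | 0 <= x]%E (f w)] by [].
apply: (@tychonoff Omega (fun=> \bar R) (fun=> [set x | 0 <= x]%E)) => w.
apply: (subclosed_compact _ (@ereal_compact R)) => //.
exact: closed_ereal_le_ereal.
Qed.

End Weights.

(** * The gap and its minimiser *)

Section StrictlyProper.
Context {R : realType} {Omega : finType}.
Context (s : credence R Omega -> score_space R Omega).
Context (s_rule : scoring_rule s) (s_strict : strictly_proper s)
  (s_closure : prob_scores s = nonneg_closure (finite_prob_scores s)).

Definition score_of (q : Omega -> R) : score_space R Omega := s (prob_of q).

Definition entropy (q : Omega -> R) : R := fine (mean q (score_of q)).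

Lemma score_mean_lt D q c : weights D q -> c <> prob_of q ->
  (mean q (score_of q) < mean q (s c))%E.
Proof.
move=> qD cq; rewrite -!expect_prob_of.
by apply: s_strict => //; exact: prob_of_probability qD.
Qed.

(** The mean score of a probability is finite because it is strictly below
    another mean score, namely that of any other credence function. *)
Lemma entropyE D q : weights D q -> mean q (score_of q) = (entropy q)%:E.
Proof.
move=> qD; rewrite fineK// ge0_fin_numE.
  have cq : [ffun A => prob_of q A + 1] <> prob_of q.
    move/ffunP/(_ finset.set0); rewrite ffunE => /eqP.
    by rewrite addrC -subr_eq0 addrK oner_eq0.
  exact: lt_le_trans (score_mean_lt qD cq) (leey _).
apply: sume_ge0 => w _; apply: mule_ge0; last exact: s_rule.
  by case: qD => q0 _ _; rewrite lee_fin.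
Qed.

Lemma entropy_le D q c : weights D q -> ((entropy q)%:E <= mean q (s c))%E.
Proof.
move=> qD; rewrite -(entropyE qD).
have [->//|/eqP cq] := eqVneq c (prob_of q).
exact/ltW/(score_mean_lt qD).
Qed.

(** By the closure hypothesis, if the entropy at q is below b then some finite
    score z of a probability has E_q z < b.  As z is finite, E_y z is continuous
    in y, and by propriety it bounds the entropy at y from above. *)
Lemma entropy_upper_semicontinuous D (q : {ptws Omega -> R}) b :
  weights D q -> entropy q < b ->
  \forall y \near q, weights D y -> entropy y < b.
Proof.
move=> qD qb; have q0 : forall w, 0 <= q w by case: qD.
have : nonneg_closure (finite_prob_scores s) (score_of q).
  by rewrite -s_closure; exists (prob_of q) => //; exact: prob_of_probability qD.
move=> [cl _].
have nb : nbhs (mean q (fun w => `|score_of q w|%E)) [set x | x < b%:E]%E.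
  rewrite mean_abse; last exact: s_rule.
  by rewrite (entropyE qD); apply: open_ereal_lt'; rewrite lte_fin.
have [_ [[[c _ <-] cfin] /=]] := cl _ (mean_abse_continuous q0 nb).
rewrite mean_abse; last exact: s_rule.
have cE (y : Omega -> R) : mean y (s c) = (\sum_w y w * fine (s c w))%:E.
  by apply: mean_EFin => w _; rewrite ge0_fin_numE; case/andP: (cfin w).
rewrite cE lte_fin => /near_linear_lt yb.
apply: (@filterS _ (nbhs q) (nbhs_filter q) _ _ _ yb) => y {}yb yD.
apply: le_lt_trans yb.
by rewrite -lee_fin -cE; exact: entropy_le yD.
Qed.

Definition gap (a q : Omega -> R) : R := (\sum_w q w * a w) - entropy q.

Lemma gap_attains_min (D : {set Omega}) (a : Omega -> R) : (0 < #|D|)%N ->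
  exists2 q, weights D q & forall y, weights D y -> gap a q <= gap a y.
Proof.
move=> /card_gt0P[w0 w0D].
apply: lower_semicontinuous_attains_min; first exact: weights_compact.
  exists (fun w => (w == w0)%:R); split=> [w|w|].
  - by [].
  - by case: eqP => // ->; rewrite w0D.
  - exact: sum_indicator.
move=> q b qD; rewrite /gap => bq.
(* e lies halfway between entropy q and its strict upper bound E_q a - b. *)
pose e := (\sum_w q w * a w - b + entropy q) / 2.
have /(entropy_upper_semicontinuous qD) : entropy q < e by rewrite /e; lra.
have : b + e < \sum_w q w * a w by rewrite /e; lra.
move=> /near_linear_gt na ne.
apply: (@filterS2 _ (nbhs q) (nbhs_filter q) _ _ _ _ na ne) => y {}na {}ne yD.
by have := ne yD; lra.
Qed.

(** Comparing the gap at [mix t q w] with its minimum at q gives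
    (1 - t) (E_q x - entropy q) <= t (a w - gap a q - x w), where x is the
    perturbed score. The left side is nonnegative by propriety, which yields
    the first bound; with t <= 1/2 and x w >= 0 it yields the second. *)
Lemma score_of_mix (D : {set Omega}) a (q : Omega -> R) w t :
  weights D q -> w \in D -> 0 < t <= 2^-1 ->
  (forall y, weights D y -> gap a q <= gap a y) ->
  (score_of (mix t q w) w <= (a w - gap a q)%:E)%E /\
  (mean q (score_of (mix t q w)) <=
     (entropy q + t * (2 * `|a w - gap a q|))%:E)%E.
Proof.
move=> qD wD /andP[t0 t2] qmin.
have q0 : forall v, 0 <= q v by case: qD.
have t1 : t < 1 by lra.
have yD : weights D (mix t q w) by apply: mix_weights => //; lra.
set x := score_of _.
have x0 : nonneg_scores x by exact: s_rule.
have xfin v : mix t q w v != 0 -> x v \is a fin_num.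
  apply: mean_fin_num => //; first by case: yD.
  by rewrite (entropyE yD) ltry.
have yw : mix t q w w != 0.
  by rewrite gt_eqF// /mix eqxx mulr1 ltr_wpDl// mulr_ge0// subr_ge0 ltW.
have yq v : q v != 0 -> mix t q w v != 0.
  move=> qv; rewrite gt_eqF// /mix ltr_pwDl ?mulr_ge0 ?(ltW t0)//.
  by rewrite mulr_gt0 ?subr_gt0// lt_neqAle eq_sym qv q0.
have qx : mean q x = (\sum_v q v * fine (x v))%:E.
  by apply: mean_EFin => v /yq; exact: xfin.
have yE : entropy (mix t q w) =
    (1 - t) * (\sum_v q v * fine (x v)) + t * fine (x w).
  by rewrite -sum_mix /entropy -/x mean_EFin.
have qle : entropy q <= \sum_v q v * fine (x v).
  by rewrite -lee_fin -qx; exact: entropy_le qD.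
have xw0 : 0 <= fine (x w) by rewrite fine_ge0.
have := qmin _ yD; rewrite /gap sum_mix yE qx -(fineK (xfin w yw)) !lee_fin.
set A := \sum_v q v * a v; set X := \sum_v _ in qle *.
set E := entropy q in qle *.
move=> ineq.
have tE : (1 - t) * (X - E) <= t * (a w - (A - E) - fine (x w)) by nra.
have pos : 0 <= t * (a w - (A - E) - fine (x w)).
  by apply: le_trans tE; rewrite mulr_ge0// subr_ge0// ltW.
have d0 : 0 <= a w - (A - E) - fine (x w) by rewrite -(pmulr_rge0 _ t0).
split; first lra.
rewrite ger0_norm; last by lra.
nra.
Qed.

(** The bound of [score_of_mix] on s(q_t)(w) passes to a cluster point of the
    scores s(q_t) as t tends to 0, and strict propriety identifies that cluster
    point with the score of q. Compactness thus replaces a proof that s is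
    continuous. *)
Lemma score_of_minimiser (D : {set Omega}) a (q : Omega -> R) w :
  weights D q -> w \in D ->
  (forall y, weights D y -> gap a q <= gap a y) ->
  (score_of q w <= (a w - gap a q)%:E)%E.
Proof.
move=> qD wD qmin.
have q0 : forall v, 0 <= q v by case: qD.
pose F := score_of (mix t q w) @[t --> (0 : R)^'+].
have small (b : R) : 0 < b -> \forall t \near (0 : R)^'+, 0 < t <= b.
  move=> b0; near=> t; apply/andP; split; near: t.
    exact: nbhs_right_gt.
  exact: nbhs_right_le.
have Fsmall (b : R) (C : set (score_space R Omega)) : 0 < b ->
    (forall t, 0 < t <= b -> C (score_of (mix t q w))) -> F C.
  by move=> /small nb bC; apply: (@filterS _ (0 : R)^'+ _ _ _ bC nb).
have FN : F (@nonneg_scores R Omega).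
  by apply: (Fsmall 1) => // t _; exact: s_rule.
have [z [z0 Fz]] := @nonneg_scores_compact R Omega F _ FN.
have zlim (C : set (score_space R Omega)) : closed C -> F C -> C z.
  by move=> cC FC; apply: cC => B Bz; exact: Fz.
have zw : (z w <= (a w - gap a q)%:E)%E.
  apply: (zlim [set x | x w <= (a w - gap a q)%:E]%E).
    apply: (@preimage_closed _ _ (fun x : score_space R Omega => x w)
      [set x | x <= (a w - gap a q)%:E]%E); last exact: closed_ereal_ge_ereal.
    by move=> x _; exact: (@proj_continuous _ (fun=> \bar R)).
  apply: (Fsmall 2^-1); first by lra.
  by move=> t t2; case: (score_of_mix qD wD t2 qmin).
(* The prob_scores form a closed set, so z is itself a score. *)
have [p pP pz] : prob_scores s z.
  apply: zlim; last first.
    apply: (Fsmall 1) => // t /andP[t0 t1].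
    exists (prob_of (mix t q w)) => //.
    by apply: (@prob_of_probability _ _ D); apply: mix_weights => //; lra.
  rewrite s_closure; apply: closedI; first exact: closed_closure.
  apply: compact_closed nonneg_scores_compact.
  apply: (@hausdorff_product Omega (fun=> \bar R)) => v.
  exact: ereal_hausdorff.
(* Each set of scores x with E_q x <= entropy q + e is closed and contains
   s(q_t) for small t. *)
have zq : (mean q z <= mean q (score_of q))%E.
  rewrite (entropyE qD); apply/lee_addgt0Pr => e e0.
  rewrite -(mean_abse _ z0) -EFinD.
  pose qmean (x : score_space R Omega) := mean q (fun v => `|x v|%E).
  apply: (zlim [set x | qmean x <= (entropy q + e)%:E]%E).
    apply: (@preimage_closed _ _ qmean [set x | x <= (entropy q + e)%:E]%E);
      last exact: closed_ereal_ge_ereal.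
    by move=> x _; exact: mean_abse_continuous.
  pose k := 2 * `|a w - gap a q| + 1.
  have k0 : 0 < k by rewrite ltr_wpDl// mulr_ge0.
  apply: (Fsmall (Num.min 2^-1 (e / k))).
    by rewrite lt_min divr_gt0// andbT; lra.
  move=> t /andP[t0]; rewrite le_min => /andP[t2 tk].
  have [|_] := score_of_mix qD wD (t := t) _ qmin; first by rewrite t0.
  rewrite /= /qmean mean_abse; last exact: s_rule.
  move=> /le_trans; apply; rewrite lee_fin lerD2l.
  move: tk; rewrite ler_pdivlMr// => /(le_trans _); apply.
  by rewrite ler_pM2l// /k lerDl.
have [pq|/eqP pq] := eqVneq p (prob_of q); first by rewrite /score_of -pq pz.
by have := score_mean_lt qD pq; rewrite pz ltNge zq.
Unshelve. all: by end_near. Qed.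

Lemma exists_probability : (0 < #|Omega|)%N ->
  exists p : credence R Omega, probabilities p.
Proof.
rewrite -cardsT => /(gap_attains_min (fun=> 0)) [q qD _].
by exists (prob_of q); exact: prob_of_probability qD.
Qed.

(** If s(c) is infinite everywhere there is no simplex to minimise over, but
    then any probability meets the conclusion. *)
Lemma dominated_on_finite c : (0 < #|Omega|)%N -> ~ probabilities c ->
  exists2 p, probabilities p & forall w, s c w != +oo%E -> (s p w < s c w)%E.
Proof.
move=> Omega0 cP; pose D := [set w | s c w != +oo%E]%SET.
have [D0|] := posnP #|D|.
  have [p pP] := exists_probability Omega0; exists p => // w cw.
  by have := card0_eq D0 w; rewrite !inE cw.
move=> /(gap_attains_min (fun w => fine (s c w)))[q qD qmin].
exists (prob_of q); first exact: prob_of_probability qD.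
move=> w cw; have wD : w \in D by rewrite inE.
have cfin v : s c v != +oo%E -> s c v \is a fin_num.
  by rewrite ge0_fin_numE ?ltey//; exact: s_rule.
have gap0 : 0 < gap (fun w => fine (s c w)) q.
  rewrite subr_gt0 -lte_fin -(entropyE qD) -mean_EFin.
    apply: (score_mean_lt qD) => cq; apply: cP; rewrite cq.
    exact: prob_of_probability qD.
  case: qD => _ qD _ v qv; apply: cfin; apply: contraNN qv => cv.
  by apply/eqP/qD; rewrite inE cv.
apply: le_lt_trans (score_of_minimiser qD wD qmin) _.
by rewrite -[ltRHS](fineK (cfin w cw)) lte_fin ltrBlDr ltrDl.
Qed.

End StrictlyProper.

(** * Domination *)

Theorem theorem1 (R : realType) (Omega : finType) (Omega_nonempty : (0 < #|Omega|)%N)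
    (s : credence R Omega -> score_space R Omega)
    (s_rule : scoring_rule s)
    (s_strict : strictly_proper s)
    (s_closure : prob_scores s = nonneg_closure (finite_prob_scores s)) :
  forall c : credence R Omega, ~ probabilities c ->
    exists2 p : credence R Omega, probabilities p &
      forall w : Omega, (s p w < s c w)%E.
Proof.
move=> c cP.
have [p0 p0P p0c] :=
  dominated_on_finite s_rule s_strict s_closure Omega_nonempty cP.
have : nonneg_closure (finite_prob_scores s) (s p0).
  by rewrite -s_closure; exists p0.
move=> [cl _].
pose N := [set x : score_space R Omega |
  forall w, s c w != +oo%E -> (x w < s c w)%E].
have nN : nbhs (s p0) N.
  apply: (@filter_forall _ Omega _ _ (nbhs_filter (s p0))) => w.
  have [->//|cw] := eqVneq (s c w) +oo%E.
    by apply: (@filterE _ _ (nbhs_filter (s p0))).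
  have lt_near := @proj_continuous Omega (fun=> \bar R) w (s p0)
    [set x | x < s c w]%E (open_ereal_lt' (p0c w cw)).
  by apply: (@filterS _ _ (nbhs_filter (s p0)) _ _ _ lt_near).
have [_ [[[p pP <-] pfin] pN]] := cl N nN.
exists p => // w; have [->|] := eqVneq (s c w) +oo%E; last exact: pN.
by case/andP: (pfin w).
Qed.
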